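(* The modified TD($\lambda$) estimator (with $\lambda\in[0,1]$) is unbiased if the Markov Reward Process is acyclic: for every state $s$ and every $m\ge1$ with $\mathbb P[K_s=m]>0$, the estimate $\bar V_s$ satisfies $\mathbb E[\bar V_s\mid K_s=m]=V_s$.
   Context: A Markov Reward Process (MRP) has a finite state space $\mathbb S$, starting probabilities $p_i$, transition probabilities $p_{ij}$, random real integrable rewards $R_{ij}$ received on a transition $i\to j$, and a discount $\gamma\in(0,1]$. Terminal states have no outgoing transitions and value (and value estimate) $0$. The value is $V_i=\sum_j p_{ij}(\mathbb E[R_{ij}]+\gamma V_j)$. The MRP is acyclic if no path of positive probability contains a state twice. I.i.d. paths are observed one after another; $K_s$ is the total number of observed visits to $s$. Modified TD($\lambda$) in the acyclic case: each state $s$ has a current estimate; let $\alpha_1,\alpha_2,\ldots\in[0,1]$ be deterministic learning rates, with $\alpha_k$ used at the $k$-th update of a state, and the modification $\alpha_1=1$. Suppose the current path visits $s$ for the $k$-th time overall; write the remainder of the path from $s$ as $\pi(1)=s,\pi(2),\pi(3),\ldots$ and let $R_{\pi(i)}$ be the reward received on leaving $\pi(i)$. The estimate of $s$ is updated to $$\bar V_s^{(k)}=(1-\alpha_k)\bar V_s^{(k-1)}+\alpha_k\Big(\sum_{i\ge1}(\gamma\lambda)^{i-1}R_{\pi(i)}+\gamma(1-\lambda)\sum_{i\ge2}(\gamma\lambda)^{i-2}\,\bar V_{\pi(i)}\Big),$$ where $\bar V_{\pi(i)}$ is the estimate of $\pi(i)$ before the current path, except that if $\pi(i)$ has not been visited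 in any previous path, its estimate is first updated with the current path (by the same rule) and this updated value is used. Here $0^0=1$. *)

(* Defs.v *)
From HB Require Import structures.
From mathcomp Require Import all_boot all_order all_algebra.
From mathcomp Require Import all_classical all_reals all_analysis.
Import Order.TTheory GRing.Theory Num.Theory.

Set Implicit Arguments.
Unset Strict Implicit.
Unset Printing Implicit Defensive.

Local Open Scope classical_set_scope.
Local Open Scope ring_scope.

(* [mrp_reward M i j] is the law of the random reward R_ij. *)
Record mrp (R : realType) (S : finType) := MRP {
  mrp_start : S -> R;
  mrp_trans : S -> S -> R;
  mrp_reward : S -> S -> probability (measurableTypeR R) R;
  mrp_discount : R;
  mrp_start_ge0 : forall i, 0 <= mrp_start i;
  mrp_start_sum : \sum_i mrp_start i = 1;
  mrp_trans_ge0 : forall i j, 0 <= mrp_trans i j;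
  mrp_trans_sum : forall i,
    (exists j, mrp_trans i j != 0) -> \sum_j mrp_trans i j = 1;
  mrp_reward_integrable : forall i j,
    (mrp_reward i j).-integrable [set: R] (fun x : R => x%:E);
  mrp_discount_gt0 : 0 < mrp_discount;
  mrp_discount_le1 : mrp_discount <= 1 }.

(* A path is a finite sequence of states, and an episode is a path together
   with its rewards: [e.2 k] is the reward received on leaving the k-th state
   (from 0) of [e.1].  As no reward is received on leaving the last state, the
   values of [e.2] from [(size e.1).-1] on are meaningless; nothing below
   depends on them. *)
Definition episode (R : realType) (S : finType) : Type :=
  (seq S * (nat -> R))%type.

Section MarkovRewardProcess.
Context {R : realType} {S : finType}.
Implicit Types (M : mrp R S) (i x : S) (xs : seq S).

Definition terminal M : pred S := [pred i | [forall j, mrp_trans M i j == 0]].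

Definition mean_reward M i j : R :=
  fine (\int[mrp_reward M i j]_x (x : R)%:E).

(* At a terminal state all terms of the sum vanish, so its value is 0. *)
Definition is_value M (V : S -> R) : Prop :=
  forall i, V i =
    \sum_j mrp_trans M i j * (mean_reward M i j + mrp_discount M * V j).

(* The probability that a path begins with the states [x :: xs]. *)
Definition path_prob M x xs : R :=
  mrp_start M x *
  \prod_(k < size xs) mrp_trans M (nth x (x :: xs) k) (nth x xs k).

Definition acyclic M : Prop :=
  forall x xs, 0 < path_prob M x xs -> uniq (x :: xs).

End MarkovRewardProcess.

Section Sampling.
Context {R : realType} {S : finType} {d : measure_display}
  {Omega : measurableType d}.
Implicit Types (M : mrp R S) (P : probability Omega R).
Implicit Types (ep : Omega -> episode R S).

(* The event that the path begins with [p] and that the rewards received along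
   [p] lie in the sets [B 0], [B 1], and so on. *)
Definition cylinder ep (p : seq S) (B : nat -> set (measurableTypeR R)) :
    set Omega :=
  [set w | prefix p (ep w).1 /\
           forall k, (k.+1 < size p)%N -> B k ((ep w).2 k)].

Definition cylinders ep : set (set Omega) :=
  [set A | exists p B, (forall k, measurable (B k)) /\ A = cylinder ep p B].

(* The states form the Markov chain of [M] and, given the states, the rewards
   are independent with the laws prescribed by the transitions.  In particular
   a path almost surely ends in a terminal state: it can be extended from any
   other state with total probability 1. *)
Definition episode_of M P ep : Prop :=
  forall x xs (B : nat -> set (measurableTypeR R)),
    (forall k, measurable (B k)) ->
    P (cylinder ep (x :: xs) B) =
    ((path_prob M x xs)%:E *
     \prod_(k < size xs)
       mrp_reward M (nth x (x :: xs) k) (nth x xs k) (B k))%E.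

(* Mutual independence of F 0, ..., F n.-1, meant for sigma-algebras F t:
   subfamilies are covered by taking the other sets to be [setT]. *)
Definition mutually_independent P (n : nat) (F : nat -> set (set Omega)) :
    Prop :=
  forall A : nat -> set Omega, (forall t, (t < n)%N -> F t (A t)) ->
    P (\bigcap_(t in `I_n) A t) = (\prod_(t < n) P (A t))%E.

(* The episodes 0, ..., n.-1 are random, independent, and distributed
   according to [M]. *)
Definition iid_episodes M P (n : nat) (ep : nat -> Omega -> episode R S) :
    Prop :=
  [/\ forall t, (t < n)%N -> cylinders (ep t) `<=` measurable,
      forall t, (t < n)%N -> episode_of M P (ep t) &
      mutually_independent P n (fun t => <<s cylinders (ep t) >>)].

Definition cond_expectation P (X : Omega -> R) (A : set Omega) : \bar R :=
  ((\int[P]_(w in A) (X w)%:E) / P A)%E.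

End Sampling.

Section TemporalDifference.
Context {R : realType} {S : finType}.
Variables (M : mrp R S) (lambda : R) (alpha : nat -> R) (V0 : S -> R).
Implicit Types (N : S -> nat) (V U : S -> R) (r : nat -> R).
Implicit Types (ep : nat -> episode R S).

Let gamma := mrp_discount M.

(* [x :: xs] is the remainder of the path and [r] are its rewards, so that
   [r k] is received on leaving the k-th state of [x :: xs], and the k-th state
   of [xs] is the (k+2)-nd state of the remainder counted from 1. *)
Definition td_target U x (xs : seq S) r : R :=
  \sum_(k < size xs) (gamma * lambda) ^+ k * r k +
  gamma * (1 - lambda) *
    \sum_(k < size xs) (gamma * lambda) ^+ k * U (nth x xs k).

(* Estimates after an episode with path [p] and rewards [r], where [N] are the
   numbers of visits and [V] the estimates before the episode.  The path is
   processed backwards, so that the estimates [W] of all states of the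
   remainder are available for those never visited before. *)
Fixpoint td_update N V (p : seq S) r : S -> R :=
  if p is x :: xs then
    let W := td_update N V xs (fun k => r k.+1) in
    let U y := if terminal M y then 0 else if N y == 0%N then W y else V y in
    let a := alpha (N x).+1 in
    fun y => if y == x then (1 - a) * V x + a * td_target U x xs r else W y
  else V.

Definition visits ep (n : nat) (s : S) : nat :=
  (\sum_(t < n) count_mem s (ep t).1)%N.

Fixpoint td_estimates ep (n : nat) : S -> R :=
  if n is n'.+1 then
    td_update (visits ep n') (td_estimates ep n') (ep n').1 (ep n').2
  else V0.

(* The estimate of [s] after [n] episodes, starting from the initial estimates
   [V0]. *)
Definition td_estimator ep (n : nat) (s : S) : R :=
  if terminal M s then 0 else td_estimates ep n s.

End TemporalDifference.

(* Main.v *)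
(* The estimates are affine in the rewards when the paths of all episodes are
   fixed.  Hence the mean of the estimate of [s] given the paths is obtained by
   running the algorithm on the mean rewards, and it remains to average over the
   finitely many lists of paths of positive probability.

   For a state [z], only the part of each path that precedes the descendants of
   [z] (and includes [z] itself, if visited) is relevant to whether and when [z]
   is visited.  The claim to be proved by induction is that, given these parts
   of all paths, the estimate of [z] has mean [V z] as soon as [z] has been
   visited.  As [alpha 1 = 1], the initial estimate plays no role.  At an update
   along a path through [z], the estimate of a later state [y] is used either
   from before that path or, if [y] is visited for the first time, from after
   it.  In both cases its mean is [V y] given the parts relevant to [y], which
   determine those relevant to [z], since [y] is below [z].  So in the mean the
   estimates in the target can be replaced by the values, and the resulting
   target is unbiased by the Bellman equation, because the rest of a path from
   [z] on does not depend on what precedes. *)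

Require Import Defs.
From HB Require Import structures.
From mathcomp Require Import all_boot all_order all_algebra.
From mathcomp Require Import all_classical all_reals all_analysis.
From mathcomp Require Import measurable_realfun ring.
Import Order.TTheory GRing.Theory Num.Theory.

Set Implicit Arguments.
Unset Strict Implicit.
Unset Printing Implicit Defensive.

Local Open Scope classical_set_scope.
Local Open Scope ring_scope.

(** * Lists of paths *)

Section Sequences.
Context {T : Type}.

Fixpoint seqs (l : seq T) n : seq (seq T) :=
  if n is n'.+1 then [seq x :: q | x <- l, q <- seqs l n'] else [:: [::]].

Fixpoint seqs_upto (l : seq T) n : seq (seq T) :=
  [::] :: if n is n'.+1 then [seq x :: q | x <- l, q <- seqs_upto l n']
          else [::].

Lemma big_seqsS (V : nmodType) (l : seq T) n (F : seq T -> V) :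
  \sum_(p <- seqs l n.+1) F p = \sum_(x <- l) \sum_(q <- seqs l n) F (x :: q).
Proof. exact: big_allpairs_dep. Qed.

Lemma big_seqs_upto0 (V : nmodType) (l : seq T) (F : seq T -> V) :
  \sum_(p <- seqs_upto l 0) F p = F [::].
Proof. by rewrite big_cons big_nil addr0. Qed.

Lemma big_seqs_uptoS (V : nmodType) (l : seq T) n (F : seq T -> V) :
  \sum_(p <- seqs_upto l n.+1) F p =
  F [::] + \sum_(x <- l) \sum_(q <- seqs_upto l n) F (x :: q).
Proof. by rewrite big_cons big_allpairs_dep. Qed.

End Sequences.

Section SequencesEq.
Context {T : eqType}.
Implicit Types (l p : seq T).

Lemma mem_seqs l n p : (p \in seqs l n) = (size p == n) && all [in l] p.
Proof.
elim: n p => [|n IH] [|x p] //=.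
  by apply/allpairsP => -[[? ?] []].
apply/allpairsP/and3P => [[[y q] /= [yl + [-> ->]]]|[sp xl pl]].
  by rewrite IH => /andP[/eqP -> ->].
by exists (x, p); rewrite IH /= -eqSS sp xl pl.
Qed.

Lemma seqs_uniq l n : uniq l -> uniq (seqs l n).
Proof.
move=> ul; elim: n => //= n IH; apply: allpairs_uniq => //.
by move=> [? ?] [? ?] _ _ [-> ->].
Qed.

Lemma mem_seqs_upto l n p :
  (p \in seqs_upto l n) = (size p <= n)%N && all [in l] p.
Proof.
elim: n p => [|n IH] [|x p] //=; rewrite inE /=.
apply/allpairsP/and3P => [[[y q] /= [yl + [-> ->]]]|[sp xl pl]].
  by rewrite IH => /andP[? ->].
by exists (x, p); rewrite IH /= -ltnS sp xl pl.
Qed.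

Lemma seqs_upto_uniq l n : uniq l -> uniq (seqs_upto l n).
Proof.
move=> ul; elim: n => //= n IH; apply/andP; split.
  by apply/allpairsP => -[[? ?] []].
by apply: allpairs_uniq => // -[? ?] [? ?] _ _ [-> ->].
Qed.

End SequencesEq.

(** * The update rule *)

Section TdTarget.
Context {R : realType} {S : finType}.
Variables (M : mrp R S) (lambda : R) (alpha : nat -> R).
Implicit Types (U V : S -> R) (N : S -> nat) (r : nat -> R) (x y : S).
Implicit Types (xs p : seq S).

Local Notation gamma := (mrp_discount M).

Lemma td_target_cons U x y ys r :
  td_target M lambda U x (y :: ys) r =
  r 0%N + gamma * (1 - lambda) * U y +
  gamma * lambda * td_target M lambda U y ys (fun k => r k.+1).
Proof.
rewrite /td_target /= !big_ord_recl /= !expr0 !mul1r.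
under eq_bigr => i _ do rewrite /bump /= add1n exprS -mulrA.
rewrite -mulr_sumr.
have -> : \sum_(i < size ys) (gamma * lambda) ^+ i.+1 * U (nth x ys i) =
    gamma * lambda * \sum_(i < size ys) (gamma * lambda) ^+ i * U (nth y ys i).
  rewrite mulr_sumr; apply: eq_bigr => i _.
  by rewrite exprS -mulrA (set_nth_default y).
by ring.
Qed.

Lemma eq_td_target U U' x xs r :
  {in xs, U =1 U'} ->
  td_target M lambda U x xs r = td_target M lambda U' x xs r.
Proof.
move=> eqU; congr (_ + _ * _); apply: eq_bigr => k _.
by rewrite eqU// mem_nth.
Qed.

Lemma td_update_notin N V p r z : z \notin p ->
  td_update M lambda alpha N V p r z = V z.
Proof.
elim: p r => //= x p IH r; rewrite inE negb_or => /andP[/negPf -> zp].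
exact: IH.
Qed.

(** In a repetition-free path the states before [z] are processed after it and leave the estimates
    of [z] and of all later states alone. Hence the intermediate estimates in the target of [z] can
    be read off the finished update. *)
Lemma td_update_in N V p r z : uniq p -> z \in p ->
  let a := alpha (N z).+1 in
  td_update M lambda alpha N V p r z =
  (1 - a) * V z + a * td_target M lambda
    (fun y => if terminal M y then 0 else
       if N y == 0%N then td_update M lambda alpha N V p r y else V y)
    z (drop (index z p).+1 p) (fun k => r (index z p + k)%N).
Proof.
elim: p r => //= x p IH r /andP[xp up]; rewrite inE.
have not_x (q : seq S) : {subset q <= p} -> {in q, forall y, (y == x) = false}.
  by move=> qp y /qp yp; apply: contraNF xp => /eqP <-.
have [-> _|_ /= zp] := eqVneq z x.
  rewrite drop0; congr (_ + _ * _); apply: eq_td_target => y yp.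
  by rewrite (not_x p).
rewrite IH//; congr (_ + _ * _).
apply: eq_td_target => y /mem_drop yp; by rewrite (not_x p).
Qed.

End TdTarget.

(** * Acyclic processes *)

Section Acyclic.
Context {R : realType} {S : finType}.
Variable M : mrp R S.
Implicit Types (x y z : S) (xs p : seq S).

Definition transition : rel S := [rel x y | mrp_trans M x y != 0].

(** Acyclicity only constrains paths of positive probability, so cycles among states that no start
    reaches are possible. Heights are therefore compared at reachable states. *)
Definition reachable x :=
  [exists x0, (mrp_start M x0 != 0) && connect transition x0 x].

(** The induction measure: comparing heights is a total stand-in for the descendant order. *)
Definition height x : nat := #|connect transition x|.

Fixpoint continuation_prob x xs : R :=
  if xs is y :: ys then mrp_trans M x y * continuation_prob y ys
  else (terminal M x)%:R.

(* Unlike [path_prob], which only asks that the path begins with [p], this is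
   the probability that the path is [p]. *)
Definition complete_path_prob p : R :=
  if p is x :: xs then mrp_start M x * continuation_prob x xs else 0.

Lemma height_gt0 x : (0 < height x)%N.
Proof. by apply/card_gt0P; exists x; rewrite inE connect0. Qed.

Lemma prod_trans_cons x y ys :
  \prod_(k < size (y :: ys))
    mrp_trans M (nth x (x :: y :: ys) k) (nth x (y :: ys) k) =
  mrp_trans M x y *
  \prod_(k < size ys) mrp_trans M (nth y (y :: ys) k) (nth y ys k).
Proof.
rewrite /= big_ord_recl /=; congr (_ * _); apply: eq_bigr => i _ /=.
by rewrite !(set_nth_default y) //= add0n// ltnW// ltnS.
Qed.

Lemma complete_path_probE x xs :
  complete_path_prob (x :: xs) =
  path_prob M x xs * (terminal M (last x xs))%:R.
Proof.
rewrite /= /path_prob -mulrA; congr (_ * _).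
elim: xs x => [|y ys IH] x; first by rewrite big_ord0 mul1r.
by rewrite prod_trans_cons -mulrA -IH.
Qed.

Lemma path_prob_gt0 x xs :
  mrp_start M x != 0 -> path transition x xs -> 0 < path_prob M x xs.
Proof.
move=> x0; rewrite /path_prob => pxs.
rewrite pmulr_rgt0; last by rewrite lt0r x0 mrp_start_ge0.
elim: xs x pxs {x0} => [|y ys IH] x; first by rewrite big_ord0.
move=> /andP[xy pys]; rewrite prod_trans_cons pmulr_rgt0; first exact: IH.
by rewrite lt0r mrp_trans_ge0 andbT.
Qed.

Lemma continuation_prob_path x xs :
  continuation_prob x xs != 0 -> path transition x xs.
Proof.
elim: xs x => //= y ys IH x; rewrite mulf_eq0 negb_or => /andP[xy /IH pys].
exact/andP.
Qed.

Lemma terminal_trans x y : terminal M x -> mrp_trans M x y = 0.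
Proof. by move=> /forallP/(_ y)/eqP. Qed.

Lemma nonterminal_trans_sum x :
  ~~ terminal M x -> \sum_y mrp_trans M x y = 1.
Proof.
by move=> /forallPn[y xy]; apply: mrp_trans_sum; exists y.
Qed.

Lemma reachable_start x : mrp_start M x != 0 -> reachable x.
Proof. by move=> x0; apply/existsP; exists x; rewrite x0 connect0. Qed.

Lemma reachable_trans x y : reachable x -> transition x y -> reachable y.
Proof.
move=> /existsP[x0 /andP[sx0 cx0]] xy; apply/existsP; exists x0.
by rewrite sx0 (connect_trans cx0)// connect1.
Qed.

Hypothesis M_acyclic : acyclic M.

(** Everything reachable from [y] is reachable from [x], but [x] is not reachable from [y]: a path
    from a start through [x] and [y] back to [x] would have positive probability and repeat [x]. *)
Lemma height_trans x y :
  reachable x -> transition x y -> (height y < height x)%N.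
Proof.
move=> /existsP[x0 /andP[sx0 /connectP[q pq xq]]] xy.
apply: proper_card; apply/properP; split.
  by apply/fintype.subsetP => z; rewrite !inE; apply/connect_trans/connect1.
exists x; first by rewrite !inE.
rewrite !inE; apply/negP => /connectP[p py xp].
have /M_acyclic : 0 < path_prob M x0 (q ++ y :: p).
  by apply: path_prob_gt0; rewrite // cat_path pq /= -xq xy.
rewrite -cat_cons cat_uniq => /and3P[_ /hasPn/(_ x) + _].
by rewrite {1}xp mem_last /= {1}xq mem_last => /(_ isT).
Qed.

Definition descending : rel S := [rel x y | (height y < height x)%N].

Lemma descending_path x xs :
  reachable x -> continuation_prob x xs != 0 -> path descending x xs.
Proof.
move=> + /continuation_prob_path.
elim: xs x => //= y ys IH x rx /andP[xy pys]; apply/andP; split.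
  exact: height_trans.
by apply: IH pys; apply: reachable_trans xy.
Qed.

Lemma descending_complete_path p :
  complete_path_prob p != 0 -> sorted descending p.
Proof.
case: p => //= x xs; rewrite mulf_eq0 negb_or => /andP[x0].
by apply/descending_path/reachable_start.
Qed.

Lemma descending_min x xs : path descending x xs ->
  {in xs, forall y, (height y < height x)%N}.
Proof.
move=> /order_path_min + y yxs => /(_ _)/allP; apply => // z t u /=.
by move=> ? /ltn_trans; apply.
Qed.

Lemma descending_uniq p : sorted descending p -> uniq p.
Proof.
apply: sorted_uniq => [z t u /= ? /ltn_trans|x /=]; first exact.
exact: ltnn.
Qed.

(* Along a descending path, the states before the first visit to
   [[pred x | height x < c]]. *)
Definition upto_height (c : nat) p := [seq x <- p | (c <= height x)%N].

Lemma mem_upto_height c p z :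
  (c <= height z)%N -> (z \in upto_height c p) = (z \in p).
Proof. by rewrite mem_filter => ->. Qed.

Lemma count_upto_height c p z :
  (c <= height z)%N -> count_mem z (upto_height c p) = count_mem z p.
Proof.
move=> cz; rewrite count_filter; apply: eq_count => x /=.
by case: eqVneq => // ->.
Qed.

(** Passing to a lower state only refines the information: the part of a path relevant to it
    determines the part relevant to a higher state. *)
Lemma upto_heightK c c' p : (c' <= c)%N ->
  upto_height c (upto_height c' p) = upto_height c p.
Proof.
move=> cc'; rewrite /upto_height -filter_predI; apply: eq_filter => x /=.
by apply/andb_idr/leq_trans.
Qed.

(** On a descending path the filter removes only a final segment, so the positions of the remaining
    states are unchanged. *)
Lemma index_upto_height c p z : sorted descending p -> z \in p ->
  (c <= height z)%N -> index z (upto_height c p) = index z p.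
Proof.
move=> + + cz; elim: p => //= x p IH dp; rewrite inE.
have [zx _|zx /= zp] := eqVneq z x; first by rewrite -zx cz /= eqxx.
have /ltnW/(leq_trans cz) -> := descending_min dp zp.
by rewrite /= eq_sym (negPf zx) IH// (path_sorted dp).
Qed.

End Acyclic.

(** * Unbiasedness for mean rewards *)

Section Unbiased.
Context {R : realType} {S : finType}.
Variables (M : mrp R S) (V : S -> R) (lambda : R) (alpha : nat -> R).
Variables (V0 : S -> R) (s0 : S).
Hypotheses (M_acyclic : acyclic M) (V_value : is_value M V).
Hypothesis alpha1 : alpha 1%N = 1.
Implicit Types (x y z : S) (xs p q : seq S) (ps qs : seq (seq S)).

Local Notation gamma := (mrp_discount M).
Local Notation tails := (seqs_upto (index_enum S)).

(** [s0] is only the default of [nth]; entries from the last state of [p] on are as meaningless as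
    the rewards there. *)
Definition mean_rewards p (k : nat) : R :=
  mean_reward M (nth s0 p k) (nth s0 p k.+1).

(** Splitting off the first state leaves a rest in [tails #|S|], and [#|S|] bounds every height, as
    the sums over continuations require. *)
Definition paths := tails #|S|.+1.

Definition paths_prob ps : R := \prod_(p <- ps) complete_path_prob M p.

Definition path_visits ps z : nat := (\sum_(p <- ps) count_mem z p)%N.

(* The most recent path comes first. *)
Fixpoint mean_estimates ps : S -> R :=
  if ps is p :: qs then
    td_update M lambda alpha (path_visits qs) (mean_estimates qs) p
      (mean_rewards p)
  else V0.

Definition mean_target z p : R :=
  td_target M lambda V z (drop (index z p).+1 p)
    (fun k => mean_rewards p (index z p + k)%N).

Lemma value_terminal x : terminal M x -> V x = 0.
Proof.
move=> tx; rewrite V_value big1// => y _.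
by rewrite (terminal_trans _ tx) mul0r.
Qed.

Lemma mean_target_head x xs :
  mean_target x (x :: xs) = td_target M lambda V x xs (mean_rewards (x :: xs)).
Proof. by rewrite /mean_target /= eqxx drop0. Qed.

Lemma mean_target_tail z x xs :
  z != x -> mean_target z (x :: xs) = mean_target z xs.
Proof. by move=> zx; rewrite /mean_target /= eq_sym (negPf zx). Qed.

Lemma path_visits_cons p ps z :
  path_visits (p :: ps) z = (count_mem z p + path_visits ps z)%N.
Proof. by rewrite /path_visits big_cons. Qed.

Lemma path_visits_upto_height c ps z : (c <= height M z)%N ->
  path_visits (map (upto_height M c) ps) z = path_visits ps z.
Proof.
move=> cz; rewrite /path_visits big_map; apply: eq_bigr => p _.
exact: count_upto_height.
Qed.

(** * Averages over the continuations of a path *)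

Lemma sum_continuation L x (F : S -> seq S -> R) :
  reachable M x -> (height M x <= L.+1)%N ->
  (forall y, reachable M y -> (height M y <= L)%N ->
    \sum_(q <- tails L) continuation_prob M y q * F y q = 0) ->
  \sum_y \sum_(q <- tails L)
    mrp_trans M x y * continuation_prob M y q * F y q = 0.
Proof.
move=> rx hx F0; apply: big1 => y _.
under eq_bigr => q _ do rewrite -mulrA.
rewrite -mulr_sumr; have [->|xy] := eqVneq (mrp_trans M x y) 0.
  by rewrite mul0r.
rewrite F0 ?mulr0//; first exact: reachable_trans xy.
by rewrite -ltnS (leq_trans (height_trans M_acyclic rx xy)).
Qed.

(** Each transition lowers the height, so a path from [x] terminates early enough for the lists of
    length at most [L] to carry the whole mass. *)
Lemma continuation_prob_sum L x : reachable M x -> (height M x <= L)%N ->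
  \sum_(q <- tails L) continuation_prob M x q = 1.
Proof.
elim: L x => [|L IH] x rx hx.
  by rewrite leqNgt height_gt0 in hx.
rewrite big_seqs_uptoS /=; have [tx|tx] := boolP (terminal M x).
  rewrite big1 ?addr0// => y _.
  by rewrite big1// => q _; rewrite (terminal_trans _ tx) mul0r.
rewrite add0r -(nonterminal_trans_sum tx); apply: eq_bigr => y _.
rewrite -mulr_sumr; have [->|xy] := eqVneq (mrp_trans M x y) 0.
  by rewrite mul0r.
rewrite IH ?mulr1//; first exact: reachable_trans xy.
by rewrite -ltnS (leq_trans (height_trans M_acyclic rx xy)).
Qed.

(** The target is the reward plus $\gamma(1-\lambda)$ times the value of the next state plus
    $\gamma\lambda$ times the target from there. By induction the latter has that same value as its
    mean, so the weights add up to $\gamma$ and the Bellman equation remains. *)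
Lemma mean_td_target_sum L x : reachable M x -> (height M x <= L)%N ->
  \sum_(q <- tails L) continuation_prob M x q *
    td_target M lambda V x q (mean_rewards (x :: q)) = V x.
Proof.
have td_nil y r : td_target M lambda V y [::] r = 0.
  by rewrite /td_target !big_ord0 mulr0 addr0.
elim: L x => [|L IH] x rx hx.
  by rewrite leqNgt height_gt0 in hx.
rewrite big_seqs_uptoS td_nil mulr0 add0r [RHS]V_value; apply: eq_bigr => y _.
have [xy0|xy] := eqVneq (mrp_trans M x y) 0.
  by rewrite xy0 mul0r big1// => q _; rewrite /= xy0 !mul0r.
have ry := reachable_trans rx xy.
have hy : (height M y <= L)%N.
  by rewrite -ltnS (leq_trans (height_trans M_acyclic rx xy)).
transitivity (mrp_trans M x y *
   ((mean_reward M x y + gamma * (1 - lambda) * V y) *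
      \sum_(q <- tails L) continuation_prob M y q +
    gamma * lambda *
      \sum_(q <- tails L) continuation_prob M y q *
        td_target M lambda V y q (mean_rewards (y :: q)))).
  rewrite 2!mulr_sumr -big_split mulr_sumr; apply: eq_bigr => q _ /=.
  rewrite td_target_cons -[mean_rewards (x :: y :: q) 0]/(mean_reward M x y).
  rewrite -[fun k => _]/(mean_rewards (y :: q)); ring.
by rewrite continuation_prob_sum// IH//; ring.
Qed.

(** All states after [x] are lower than [x], so the filtered path is [[:: x]] for every continuation
    and [g] factors out of the mean. *)
Lemma continuation_target_unbiased_head L x (g : seq S -> R) :
  reachable M x -> (height M x <= L)%N ->
  \sum_(q <- tails L) continuation_prob M x q *
    ((x \in x :: q)%:R * g (upto_height M (height M x) (x :: q)) *
     (mean_target x (x :: q) - V x)) = 0.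
Proof.
move=> rx hx.
transitivity (g [:: x] * (\sum_(q <- tails L) continuation_prob M x q *
    td_target M lambda V x q (mean_rewards (x :: q)) -
    V x * \sum_(q <- tails L) continuation_prob M x q)).
  rewrite mulr_sumr -sumrB mulr_sumr; apply: eq_bigr => q _.
  have [->|/(descending_path M_acyclic rx)/descending_min dq] :=
    eqVneq (continuation_prob M x q) 0; first by ring.
  rewrite mem_head mean_target_head /upto_height /= leqnn.
  rewrite (_ : [seq _ <- q | _] = [::]); first by ring.
  apply/eqP; rewrite -[_ == _]negbK -has_filter; apply/hasPn => y /dq.
  by rewrite -ltnNge.
by rewrite mean_td_target_sum// continuation_prob_sum// mulr1 subrr mulr0.
Qed.

(** The Markov property: what precedes [z] is absorbed into the test function [g] one state at a
    time, until the path stands at [z]. *)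
Lemma continuation_target_unbiased L x z (g : seq S -> R) :
  reachable M x -> (height M x <= L)%N ->
  \sum_(q <- tails L) continuation_prob M x q *
    ((z \in x :: q)%:R * g (upto_height M (height M z) (x :: q)) *
     (mean_target z (x :: q) - V z)) = 0.
Proof.
elim: L x g => [|L IH] x g rx hx; (have [<-|xz] := eqVneq x z;
  first exact: continuation_target_unbiased_head).
  by rewrite big_seqs_upto0 mem_seq1 eq_sym (negPf xz) !mul0r mulr0.
rewrite big_seqs_uptoS mem_seq1 eq_sym (negPf xz) !mul0r mulr0 add0r.
pose F y q : R := (z \in y :: q)%:R *
  g (upto_height M (height M z) [:: x, y & q]) * (mean_target z (y :: q) - V z).
rewrite -[RHS](@sum_continuation L x F rx hx) => [|y ry hy].
  apply: eq_bigr => y _; apply: eq_bigr => q _.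
  by rewrite in_cons eq_sym (negPf xz) mean_target_tail// eq_sym.
pose g' p := g ((if (height M z <= height M x)%N then [:: x] else [::]) ++ p).
rewrite -[RHS](IH y g' ry hy); apply: eq_bigr => q _.
by rewrite /F /g' /upto_height [in LHS]/=; case: ifP.
Qed.

Lemma path_target_unbiased z (g : seq S -> R) :
  \sum_(p <- paths) complete_path_prob M p *
    ((z \in p)%:R * g (upto_height M (height M z) p) *
     (mean_target z p - V z)) = 0.
Proof.
rewrite big_seqs_uptoS /= mul0r add0r big1// => x _.
under eq_bigr => q _ do rewrite -mulrA.
rewrite -mulr_sumr; have [->|/reachable_start rx] := eqVneq (mrp_start M x) 0.
  by rewrite mul0r.
by rewrite continuation_target_unbiased ?mulr0// max_card.
Qed.

(** * The bias of an estimate in terms of other biases *)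

Lemma mem_drop_index p y z : sorted (descending M) p -> z \in p ->
  (y \in drop (index z p).+1 p) = (y \in p) && (height M y < height M z)%N.
Proof.
elim: p => //= x p IH dp; rewrite inE.
have [zx _|zx /= zp] := eqVneq z x.
  rewrite drop0 -zx in_cons; have [->|yz] := eqVneq y z.
    rewrite ltnn andbF; apply/negP; rewrite {1}zx => /(descending_min dp).
    by rewrite ltnn.
  apply/esym/andb_idr => /(descending_min dp); by rewrite zx.
rewrite IH ?(path_sorted dp)// in_cons; case: eqVneq => [->|//].
rewrite ltnNge (ltnW (descending_min dp zp)) !andbF//.
Qed.

Lemma index_drop p y n : uniq p -> y \in drop n p ->
  index y (drop n p) = (index y p - n)%N.
Proof.
move=> + yn; have [np|/ltnW pn] := leqP n (size p); last first.
  by rewrite drop_oversize in yn.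
rewrite -{1 3}(cat_take_drop n p) cat_uniq => /and3P[_ /hasPn/(_ _ yn)/= yt _].
by rewrite index_cat (negPf yt) size_takel// addKn.
Qed.

(* The weight, up to the factor [gamma * (1 - lambda)], of the estimate of [y]
   in the update target of [z] along the path [p]. *)
Definition successor_weight z p y : R :=
  if [&& z \in p, y \in p & (height M y < height M z)%N]
  then (gamma * lambda) ^+ (index y p - (index z p).+1) else 0.

(** When the weight is nonzero, [z] is above [y] and thus lies in the part of the path kept for [y].
    So the weight is determined by what is relevant to [y]. *)
Lemma successor_weight_upto_height z p y : sorted (descending M) p ->
  successor_weight z (upto_height M (height M y) p) y = successor_weight z p y.
Proof.
move=> dp; rewrite /successor_weight.
have [hyz|] := boolP (height M y < height M z)%N; last by rewrite !andbF.
rewrite !mem_upto_height ?(ltnW hyz)// !andbT.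
case: ifP => // /andP[zp yp].
by rewrite !index_upto_height// ltnW.
Qed.

Lemma td_target_bias (U : S -> R) z p : sorted (descending M) p -> z \in p ->
  td_target M lambda U z (drop (index z p).+1 p)
    (fun k => mean_rewards p (index z p + k)%N) - V z =
  (mean_target z p - V z) +
  gamma * (1 - lambda) * \sum_y successor_weight z p y * (U y - V y).
Proof.
move=> dp zp; rewrite /mean_target /td_target.
set q := drop _ p.
have -> : \sum_y successor_weight z p y * (U y - V y) =
    \sum_(k < size q) (gamma * lambda) ^+ k * U (nth z q k) -
    \sum_(k < size q) (gamma * lambda) ^+ k * V (nth z q k).
  have uq : uniq q by rewrite drop_uniq// (descending_uniq dp).
  rewrite -sumrB.
  (* As [q] has no repetitions, its positions correspond to states. *)
  transitivity (\sum_(y <- q) (gamma * lambda) ^+ (index y q) * (U y - V y)).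
    rewrite (big_uniq _ uq) [RHS]big_mkcond; apply: eq_bigr => y _.
    rewrite /successor_weight zp /= -mem_drop_index// -/q.
    case: ifPn => [yq|_]; last by rewrite mul0r.
    by rewrite [in RHS]/q index_drop// (descending_uniq dp).
  rewrite (big_nth z) big_mkord; apply: eq_bigr => k _.
  by rewrite index_uniq// mulrBr.
by ring.
Qed.

(** The factor [(0 < path_visits qs z)%:R] can be inserted because [alpha 1 = 1] gives the old
    estimate weight 0 at the first visit. Terminal states contribute no bias, their value being
    0. *)
Lemma mean_estimates_in p qs z : sorted (descending M) p -> z \in p ->
  let a := alpha (path_visits qs z).+1 in
  mean_estimates (p :: qs) z - V z =
  (1 - a) * ((0 < path_visits qs z)%:R * (mean_estimates qs z - V z)) +
  a * (mean_target z p - V z) +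
  \sum_y a * (gamma * (1 - lambda)) * successor_weight z p y *
    (if terminal M y then 0 else
     if path_visits qs y == 0%N then mean_estimates (p :: qs) y - V y
     else mean_estimates qs y - V y).
Proof.
move=> dp zp a; rewrite {1}/mean_estimates -/mean_estimates.
rewrite td_update_in ?(descending_uniq dp)// -/a.
transitivity ((1 - a) * (mean_estimates qs z - V z) +
  a * (td_target M lambda (fun y => if terminal M y then 0 else
       if path_visits qs y == 0%N then mean_estimates (p :: qs) y
       else mean_estimates qs y) z (drop (index z p).+1 p)
       (fun k => mean_rewards p (index z p + k)%N) - V z)).
  by rewrite [mean_estimates (p :: qs)]/=; ring.
rewrite td_target_bias// [a * (_ + _)]mulrDr addrA; congr (_ + _ + _).
  have [|visited] := posnP (path_visits qs z); last by rewrite mul1r.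
  by rewrite /a => ->; rewrite alpha1 subrr !mul0r.
rewrite !mulr_sumr; apply: eq_bigr => y _; rewrite !mulrA; congr (_ * _).
case: ifP => [ty|_]; first by rewrite value_terminal// subrr.
by case: ifP.
Qed.

Lemma mean_estimates_notin p qs z : z \notin p ->
  mean_estimates (p :: qs) z = mean_estimates qs z.
Proof. exact: td_update_notin. Qed.

Lemma paths_prob_cons p qs :
  paths_prob (p :: qs) = complete_path_prob M p * paths_prob qs.
Proof. by rewrite /paths_prob big_cons. Qed.

(** The three sources of bias are the old estimate of [z], the target with exact values, and the
    estimates of later states. They vanish on average by induction on the number of episodes, by
    [path_target_unbiased], and by induction on the height. *)
Lemma mean_estimates_decomposition p qs z (g : seq (seq S) -> R) :
  let a := alpha (path_visits qs z).+1 in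
  let G := g (map (upto_height M (height M z)) (p :: qs)) in
  paths_prob (p :: qs) * ((0 < path_visits (p :: qs) z)%:R * G *
     (mean_estimates (p :: qs) z - V z)) =
  paths_prob qs * ((0 < path_visits qs z)%:R *
     (complete_path_prob M p * G * (if z \in p then 1 - a else 1)) *
     (mean_estimates qs z - V z)) +
  paths_prob qs * a * (complete_path_prob M p *
     ((z \in p)%:R * G * (mean_target z p - V z))) +
  \sum_y paths_prob (p :: qs) * (a * (gamma * (1 - lambda)) * G *
    successor_weight z p y *
    (if terminal M y then 0 else
     if path_visits qs y == 0%N then mean_estimates (p :: qs) y - V y
     else mean_estimates qs y - V y)).
Proof.
move=> a G; rewrite paths_prob_cons.
have [p0|/(descending_complete_path M_acyclic) dp] :=
    eqVneq (complete_path_prob M p) 0.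
  by rewrite p0 big1 => [|y _]; ring.
rewrite path_visits_cons; have [zp|zp] := boolP (z \in p).
  rewrite addn_gt0 -has_count has_pred1 zp mean_estimates_in//=.
  rewrite !mulrDr mul1r -/a; congr (_ + _ + _); try ring.
  by rewrite !mulr_sumr; apply: eq_bigr => y _; ring.
rewrite (count_memPn zp) add0n mean_estimates_notin// big1 => [|y _].
  by rewrite !mul0r !mulr0 !addr0; ring.
by rewrite /successor_weight (negPf zp) /=; ring.
Qed.

(** The arbitrary test function [g] expresses conditioning on the relevant parts of all paths, and
    lets the induction hypotheses absorb weights and indicators. *)
Lemma mean_estimates_unbiased n z (g : seq (seq S) -> R) :
  \sum_(ps <- seqs paths n) paths_prob ps *
    ((0 < path_visits ps z)%:R * g (map (upto_height M (height M z)) ps) *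
     (mean_estimates ps z - V z)) = 0.
Proof.
(* The outer induction on the height is uniform in [n], since estimates of lower states are used
   both after [n] and after [n.+1] episodes. *)
have [c] := ubnP (height M z); elim: c => // c IHc in n z g *.
rewrite ltnS => hz; elim: n g => [|n IHn] g.
  by rewrite big_seq1 /path_visits big_nil !mul0r mulr0.
rewrite big_seqsS.
under eq_bigr => p _ do under eq_bigr => qs _ do
  rewrite mean_estimates_decomposition.
under eq_bigr => p _ do rewrite 2!big_split /=.
rewrite 2!big_split /= [X in X + _ + _]big1 ?add0r => [|p _]; last first.
  (* For a fixed newest path [p], the factors depend on the older paths only through their relevant
     parts, so they form a test function. *)
  pose gp l := complete_path_prob M p *
    g (upto_height M (height M z) p :: l) *
    (if z \in p then 1 - alpha (path_visits l z).+1 else 1).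
  rewrite -[RHS](IHn gp); apply: eq_bigr => qs _.
  by rewrite /gp path_visits_upto_height.
rewrite exchange_big /= [X in X + _]big1 ?add0r => [|qs _]; last first.
  rewrite -mulr_sumr (path_target_unbiased z (fun q =>
    g (q :: map (upto_height M (height M z)) qs))).
  by rewrite mulr0.
under eq_bigr => p _ do rewrite exchange_big /=.
rewrite exchange_big /= big1// => y _.
have [ty|ty] := boolP (terminal M y).
  by rewrite big1// => p _; rewrite big1// => qs _; rewrite !mulr0.
have [hyz|hyz] := ltnP (height M y) (height M z); last first.
  rewrite big1// => p _; rewrite big1// => qs _.
  by rewrite /successor_weight ltnNge hyz !andbF mulr0 mul0r mulr0.
(* The coefficient of the bias of [y]; by [gzE] it is a function of the parts relevant to [y]. *)
pose gz p qs := alpha (path_visits qs z).+1 * (gamma * (1 - lambda)) *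
  g (map (upto_height M (height M z)) (p :: qs)) * successor_weight z p y.
have gzE p qs : sorted (descending M) p ->
    gz (upto_height M (height M y) p) (map (upto_height M (height M y)) qs) =
    gz p qs.
  move=> dp; rewrite /gz path_visits_upto_height 1?ltnW//.
  rewrite successor_weight_upto_height// -map_cons -map_comp.
  congr (_ * g _ * _); apply: eq_map => q /=.
  by rewrite upto_heightK// ltnW.
(* [g1] selects the case that [p] is the first path through [y], whose estimate is then taken after
   [p]; [g2] selects an earlier visit, with the estimate from before [p]. *)
pose g1 l := if l is q :: l then (path_visits l y == 0%N)%:R * gz q l else 0.
pose g2 p l := complete_path_prob M p * (path_visits l y != 0%N)%:R *
  gz (upto_height M (height M y) p) l.
have hy : (height M y < c)%N by apply: leq_trans hz.
transitivity (\sum_(ps <- seqs paths n.+1) paths_prob ps *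
      ((0 < path_visits ps y)%:R * g1 (map (upto_height M (height M y)) ps) *
       (mean_estimates ps y - V y)) +
    \sum_(p <- paths) \sum_(qs <- seqs paths n) paths_prob qs *
      ((0 < path_visits qs y)%:R *
       g2 p (map (upto_height M (height M y)) qs) *
       (mean_estimates qs y - V y))); last first.
  by rewrite IHc// add0r big1// => p _; exact: IHc.
rewrite big_seqsS -big_split; apply: eq_bigr => p _.
rewrite -big_split; apply: eq_bigr => qs _.
rewrite paths_prob_cons -/(gz p qs) [g1 _]/= /g2.
have [p0|/(descending_complete_path M_acyclic) dp] :=
    eqVneq (complete_path_prob M p) 0; first by rewrite p0 /=; ring.
rewrite gzE// path_visits_upto_height// path_visits_cons.
have [yp|yp] := boolP (y \in p); last first.
  by rewrite /gz /successor_weight (negPf yp) andbF /=; ring.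
rewrite addn_gt0 -has_count has_pred1 yp /= lt0n.
by case: eqP => _ /=; ring.
Qed.

End Unbiased.

(** * Averaging over the rewards *)

Section ScaledLaw.
Context {R : realType} {d d' : measure_display}.
Context {T : measurableType d} {Y : measurableType d'}.
Variables (P : {measure set T -> \bar R}) (E : set T) (X : T -> Y).
Variables (mu : {measure set Y -> \bar R}) (c : {nonneg R}) (y0 : Y).
Hypotheses (mE : measurable E) (mX : measurable_fun E X).
Hypothesis (m_y0 : measurable [set y0]).
Hypothesis X_law :
  forall B, measurable B -> P (E `&` X @^-1` B) = (c%:num%:E * mu B)%E.

(* Extending [X] by [y0] outside of [E] only adds mass at [y0], where [f]
   vanishes. *)
Lemma ge0_integral_scaled_law (f : Y -> \bar R) :
  measurable_fun setT f -> (forall y, 0 <= f y)%E -> f y0 = 0%E ->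
  (\int[P]_(w in E) f (X w) = c%:num%:E * \int[mu]_y f y)%E.
Proof.
move=> mf f0 fy0; pose phi w := if w \in E then X w else y0.
have phiE B : phi @^-1` B =
    (E `&` X @^-1` B) `|` (if y0 \in B then ~` E else set0).
  apply/seteqP; split => w /=; rewrite /phi; have [Ew|Ew] := boolP (w \in E).
  - by move=> Bw; left; split => //; exact: set_mem.
  - by move=> By; right; rewrite mem_set//= => /mem_set; exact/negP.
  - by case=> [[]|]//; case: ifP => // _ /(_ (set_mem Ew)).
  - by case=> [[/mem_set]|]; [rewrite (negPf Ew)|case: ifP => // /set_mem].
have mphi : measurable_fun setT phi.
  move=> _ B mB; rewrite setTI phiE; apply: measurableU; first exact: mX.
  by case: ifP => // _; exact: measurableC.
have fE (nu : {measure set Y -> \bar R}) :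
    (\int[nu]_y f y = \int[nu]_(y in [set~ y0]) f y)%E.
  rewrite [RHS]integral_mkcond; apply: eq_integral => y _.
  rewrite /patch; case: ifPn => // /negP; rewrite inE => /contrapT ->.
  by rewrite fy0.
have m0 : measurable [set~ y0] by exact: measurableC.
transitivity (\int[P]_w f (phi w))%E.
  rewrite integral_mkcond; apply: eq_integral => w _.
  by rewrite /phi /patch; case: ifP => _; rewrite ?fy0.
pose nu : {measure set Y -> \bar R} :=
  measure_function_pushforward__canonical__measure_function_Measure P mphi.
transitivity (\int[nu]_y f y)%E.
  by rewrite (ge0_integral_pushforward mphi).
rewrite (fE nu) (fE mu) -ge0_integral_mscale//; last exact: measurable_funTS.
apply: eq_measure_integral => B mB B0; rewrite -[RHS]X_law//.
rewrite /pushforward; congr (P _); apply/seteqP; split => w /=.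
  rewrite /phi; case: ifPn => [/set_mem //|_ Bw].
  by have := B0 _ Bw; rewrite /= => /(_ erefl).
by case=> Ew; rewrite /phi mem_set.
Qed.

Lemma integrable_scaled_law (f : Y -> \bar R) : f y0 = 0%E ->
  mu.-integrable setT f -> P.-integrable E (f \o X).
Proof.
move=> f0 /integrableP[mf imu]; apply/integrableP; split.
  exact: measurableT_comp.
rewrite (@ge0_integral_scaled_law (fun y => `|f y|%E))//.
- by rewrite lte_mul_pinfty.
- exact: measurableT_comp.
- by rewrite f0 abse0.
Qed.

Lemma integral_scaled_law (f : Y -> \bar R) : f y0 = 0%E ->
  mu.-integrable setT f ->
  (\int[P]_(w in E) f (X w) = c%:num%:E * \int[mu]_y f y)%E.
Proof.
move=> f0 imu; have mf := measurable_int _ imu.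
rewrite integralE [in RHS]integralE muleBr//; last first.
  by rewrite fin_num_adde_defr// integrable_pos_fin_num.
rewrite -[fun w => f (X w)]/(f \o X) funepos_comp funeneg_comp.
congr (_ - _)%E; apply: ge0_integral_scaled_law => //.
- exact/measurable_funepos.
- by rewrite funeposE f0 maxxx.
- exact/measurable_funeneg.
- by rewrite funenegE f0 oppe0 maxxx.
Qed.

End ScaledLaw.

(** * The law of the path and one reward of an episode *)

Section EpisodeLaw.
Context {R : realType} {S : finType} {d : measure_display}.
Context {Omega : measurableType d}.
Variables (M : mrp R S) (P : probability Omega R).
Variable ep : Omega -> episode R S.
Hypotheses (m_ep : cylinders ep `<=` measurable) (P_ep : episode_of M P ep).
Implicit Types (p xs : seq S) (B : set (measurableTypeR R)).

(* The condition on [B] is void when no reward is received on leaving the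
   [k]-th state of [p]. *)
Definition path_event p (k : nat) B : set Omega :=
  [set w | (ep w).1 = p /\ ((k.+1 < size p)%N -> B ((ep w).2 k))].

(** Constraining a single reward is enough: the estimates are affine in the rewards, so only the law
    of each reward given the paths enters. *)
Definition one_reward p (k : nat) B : nat -> set (measurableTypeR R) :=
  fun i => if (i == k) && (k.+1 < size p)%N then B else setT.

Lemma measurable_one_reward p k B i :
  measurable B -> measurable (one_reward p k B i).
Proof. by rewrite /one_reward; case: ifP. Qed.

Lemma cylinder_one_reward p q k B : (size p <= size q)%N ->
  cylinder ep q (one_reward p k B) =
  [set w | prefix q (ep w).1 /\ ((k.+1 < size p)%N -> B ((ep w).2 k))].
Proof.
move=> pq; apply/seteqP; split => w [pw Bw]; split => //.
  move=> kp; have := Bw k (leq_trans kp pq).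
  by rewrite /one_reward eqxx kp; apply.
move=> i iq; rewrite /one_reward; by case: ifP => // /andP[/eqP -> /Bw].
Qed.

Lemma cylinder_rcons p j k B : cylinder ep (rcons p j) (one_reward p k B) =
  [set w | prefix (rcons p j) (ep w).1 /\
           ((k.+1 < size p)%N -> B ((ep w).2 k))].
Proof. by rewrite cylinder_one_reward// size_rcons. Qed.

(** Cylinders fix only an initial segment; the path is exactly [p] when it begins with [p] but with
    no extension of [p] by one state. *)
Lemma path_event_cons x xs k B (p := x :: xs) :
  path_event p k B = cylinder ep p (one_reward p k B) `\`
    \bigcup_(j in [set: S]) cylinder ep (rcons p j) (one_reward p k B).
Proof.
rewrite /path_event cylinder_one_reward//; apply/seteqP; split => w /=.
  move=> [pE Bw]; rewrite pE prefix_refl; split => // -[j _].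
  rewrite -rcons_cons cylinder_rcons => -[/size_prefix].
  by rewrite pE size_rcons ltnn.
move=> [[/prefixP[[|j r] pE] Bw] not_longer]; first by rewrite pE cats0.
exfalso; apply: not_longer; exists j => //.
rewrite -rcons_cons cylinder_rcons; split => //.
by rewrite pE -cat_rcons prefix_prefix.
Qed.

Lemma path_event_nil k B : path_event [::] k B =
  ~` \bigcup_(x in [set: S]) cylinder ep [:: x] (fun=> setT).
Proof.
apply/seteqP; split => w /=.
  by move=> [pE _] [x _ [+ _]]; rewrite pE.
move=> nw; split => //; case pE : (ep w).1 => [//|x xs]; exfalso; apply: nw.
by exists x => //; split => //; rewrite pE prefix_cons eqxx prefix0s.
Qed.

Lemma path_event_sigma p k B :
  measurable B -> <<s cylinders ep >> (path_event p k B).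
Proof.
move=> mB; pose T := g_sigma_algebraType (cylinders ep).
have mcyl q (B' : nat -> set (measurableTypeR R)) :
    (forall i, measurable (B' i)) ->
    measurable (cylinder ep q B' : set T).
  by move=> mB'; apply: sub_sigma_algebra; exists q, B'.
change (measurable (path_event p k B : set T)).
case: p => [|x xs].
  rewrite path_event_nil.
  apply: measurableC; apply: fin_bigcup_measurable => [|j _].
    exact: finite_finset.
  exact: mcyl.
rewrite path_event_cons.
have mB' i := measurable_one_reward (x :: xs) k i mB.
apply: measurableD; first exact: mcyl.
by apply: fin_bigcup_measurable => [|j _]; [exact: finite_finset|exact: mcyl].
Qed.

Lemma measurable_path_event p k B :
  measurable B -> measurable (path_event p k B).
Proof.
move=> mB; apply: (smallest_sub _ m_ep (path_event_sigma p k mB)).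
exact: sigma_algebra_measurable.
Qed.

Lemma path_prob_rcons x xs j :
  path_prob M x (rcons xs j) = path_prob M x xs * mrp_trans M (last x xs) j.
Proof.
rewrite /path_prob -mulrA; congr (_ * _).
elim: xs x => [|y ys IH] x; first by rewrite big_ord_recl !big_ord0 mulr1 mul1r.
by rewrite rcons_cons !prod_trans_cons IH mulrA.
Qed.

Lemma prod_one_reward x xs ys k B : prefix xs ys ->
  (\prod_(i < size ys) mrp_reward M (nth x (x :: ys) i) (nth x ys i)
     (one_reward (x :: xs) k B i) =
   if (k < size xs)%N
   then mrp_reward M (nth x (x :: xs) k) (nth x xs k) B else 1)%E.
Proof.
move=> /prefixP[zs ->]; rewrite /one_reward; case: ifPn => kxs; last first.
  by apply: big1 => i _; rewrite /= ltnS (negPf kxs) andbF probability_setT.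
have kys : (k < size (xs ++ zs))%N by rewrite size_cat ltn_addr.
rewrite (bigD1 (Ordinal kys))//= eqxx ltnS kxs /= big1 ?mule1 => [|i ik].
  rewrite nth_cat kxs; case: k kxs {kys} => //= k kxs.
  by rewrite nth_cat (ltnW kxs).
rewrite ifF ?probability_setT//; apply: contraNF ik => /andP[/eqP ik _].
exact/eqP/val_inj.
Qed.

Lemma one_cylinder_prob x xs ys k B : measurable B -> prefix xs ys ->
  P (cylinder ep (x :: ys) (one_reward (x :: xs) k B)) =
  ((path_prob M x ys)%:E *
   if (k < size xs)%N
   then mrp_reward M (nth x (x :: xs) k) (nth x xs k) B else 1)%E.
Proof.
move=> mB xys; rewrite P_ep ?prod_one_reward// => i.
exact: measurable_one_reward.
Qed.

Lemma prob_bigcup_finType (F : S -> set Omega) :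
  (forall j, measurable (F j)) -> trivIset setT F ->
  P (\bigcup_(j in [set: S]) F j) = (\sum_j P (F j))%E.
Proof.
move=> mF tF; rewrite measure_fin_bigcup//; last exact: finite_finset.
rewrite [RHS]fsbig_seq ?index_enum_uniq//; apply: eq_fsbigl.
by apply/seteqP; split => j //= _; rewrite mem_index_enum.
Qed.

(** The one-state extensions take away the whole mass of the cylinder, unless the last state is
    terminal, when they take none. The reward factor is common to all these cylinders. *)
Lemma path_event_prob x xs k B : measurable B ->
  P (path_event (x :: xs) k B) =
  ((complete_path_prob M (x :: xs))%:E *
   if (k < size xs)%N
   then mrp_reward M (nth x (x :: xs) k) (nth x xs k) B else 1)%E.
Proof.
move=> mB; rewrite path_event_cons.
set L := (if _ then _ else _).
have mcyl q : measurable (cylinder ep q (one_reward (x :: xs) k B)).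
  apply: m_ep; exists q, (one_reward (x :: xs) k B); split => // i.
  exact: measurable_one_reward.
have Lfin : L \is a fin_num.
  by rewrite /L; case: ifP => // _; exact: fin_num_measure.
rewrite measureD//; last 2 first.
  by apply: fin_bigcup_measurable => //; exact: finite_finset.
  by rewrite ltey_eq fin_num_measure.
rewrite setIidr => [|w [j _]]; last first.
  rewrite cylinder_rcons cylinder_one_reward// => -[jw Bw]; split => //.
  exact: prefix_trans (prefix_rcons _ _) jw.
rewrite [X in (_ - X)%E]prob_bigcup_finType//; last first.
  apply/trivIsetP => i j _ _ ij; rewrite -subset0 => w [].
  rewrite !cylinder_rcons => -[/prefixP[r wr] _] [/prefixP[r'] /eqP].
  by rewrite wr -!cats1 -!catA eqseq_cat// eqxx /= eqseq_cons (negPf ij).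
under eq_bigr => j _ do
  rewrite rcons_cons one_cylinder_prob ?prefix_rcons// path_prob_rcons.
rewrite [X in (X - _)%E]one_cylinder_prob ?prefix_refl// -/L -(fineK Lfin).
rewrite -EFinM (eq_bigr (fun j =>
    (path_prob M x xs * mrp_trans M (last x xs) j * fine L)%:E)) => [|j _];
  last by rewrite EFinM.
rewrite sumEFin -EFinB complete_path_probE EFinM -EFinM; congr EFin.
rewrite -mulr_suml -mulr_sumr; have [tx|tx] := boolP (terminal M (last x xs)).
  rewrite big1 => [|j _]; last exact: terminal_trans.
  by rewrite mulr0 mul0r subr0 mulr1.
by rewrite nonterminal_trans_sum//=; ring.
Qed.

Lemma path_event_nil_prob k B : P (path_event [::] k B) = 0%E.
Proof.
rewrite path_event_nil.
have mcyl q : measurable (cylinder ep q (fun=> setT)).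
  by apply: m_ep; exists q, (fun=> setT).
rewrite probability_setC; last first.
  by apply: fin_bigcup_measurable => //; exact: finite_finset.
rewrite prob_bigcup_finType//; last first.
  apply/trivIsetP => i j _ _ ij; rewrite -subset0 => w [[+ _] [+ _]].
  case: (ep w).1 => // y ys; rewrite !prefix_cons => /andP[/eqP iy _].
  by move=> /andP[/eqP jy _]; rewrite iy jy eqxx in ij.
under eq_bigr => j _ do rewrite P_ep// big_ord0 mule1 /path_prob big_ord0 mulr1.
by rewrite sumEFin mrp_start_sum subee.
Qed.

End EpisodeLaw.

(** * The joint law of all paths and one reward *)

Section EpisodesLaw.
Context {R : realType} {S : finType} {d : measure_display}.
Context {Omega : measurableType d}.
Variables (M : mrp R S) (P : probability Omega R) (s0 : S).

Lemma path_event_probE (ep : Omega -> episode R S) p k B :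
  cylinders ep `<=` measurable -> episode_of M P ep -> measurable B ->
  P (path_event ep p k B) =
  ((complete_path_prob M p)%:E * if (k.+1 < size p)%N
   then mrp_reward M (nth s0 p k) (nth s0 p k.+1) B else 1)%E.
Proof.
case: p => [|x xs] m_ep P_ep mB.
  by rewrite (path_event_nil_prob m_ep P_ep) mul0e.
rewrite (path_event_prob m_ep P_ep)// ltnS; case: ifP => // kxs.
by rewrite /= !(set_nth_default s0)//= ltnS ltnW.
Qed.

Variables (n : nat) (ep : nat -> Omega -> episode R S).
Hypothesis ep_iid : iid_episodes M P n ep.
Implicit Types (ps : seq (seq S)) (X Y : Omega -> R) (x y c : R).

(* The paths of the first [t] episodes, the most recent one first. *)
Definition past_paths (e : nat -> episode R S) (t : nat) : seq (seq S) :=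
  rev (mkseq (fun i => (e i).1) t).

Definition paths_event ps : set Omega :=
  [set w | past_paths (ep ^~ w) n = ps].

Definition nth_path ps t : seq S := nth [::] (rev ps) t.

Lemma paths_eventP ps w : size ps = n ->
  paths_event ps w <-> forall t, (t < n)%N -> (ep t w).1 = nth_path ps t.
Proof.
move=> sps; rewrite /paths_event /= /past_paths /nth_path; split => [<- t tn|E].
  by rewrite revK nth_mkseq.
apply: (can_inj revK); rewrite revK.
apply: (@eq_from_nth _ [::]); rewrite size_mkseq ?size_rev// => t tn.
by rewrite nth_mkseq// E.
Qed.

Lemma paths_event_bigcap ps t0 k B : size ps = n ->
  paths_event ps `&`
    [set w | (k.+1 < size (nth_path ps t0))%N -> B ((ep t0 w).2 k)] =
  \bigcap_(t in `I_n)
    path_event (ep t) (nth_path ps t) k (if t == t0 then B else setT).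
Proof.
move=> sps; apply/seteqP; split => w.
  move=> [/(paths_eventP _ sps) E Bw] t /= tn; split; first exact: E.
  by case: eqP => // ->.
move=> E; split; first by apply/paths_eventP => // t /E[].
move=> kt0; have t0n : (t0 < n)%N.
  rewrite ltnNge; apply: contraTN kt0 => nt0.
  by rewrite /nth_path nth_default// size_rev sps.
by have [_ /(_ kt0)] := E _ t0n; rewrite eqxx.
Qed.

(** As an intersection of one event per episode, the event has a probability that factors by
    independence; only episode [t0] can contribute a reward. *)
Lemma paths_event_law ps t0 k B : size ps = n -> measurable B ->
  P (paths_event ps `&`
    [set w | (k.+1 < size (nth_path ps t0))%N -> B ((ep t0 w).2 k)]) =
  ((paths_prob M ps)%:E * if (k.+1 < size (nth_path ps t0))%N
   then mrp_reward M (nth s0 (nth_path ps t0) k)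
     (nth s0 (nth_path ps t0) k.+1) B else 1)%E.
Proof.
move=> sps mB; have [m_ep P_ep indep] := ep_iid.
have mBt t : measurable (if t == t0 then B else setT) by case: ifP.
rewrite paths_event_bigcap// indep => [|t tn]; last first.
  by apply: path_event_sigma; exact: mBt.
under eq_bigr => t _ do rewrite (path_event_probE _ _
  (m_ep t (ltn_ord t)) (P_ep t (ltn_ord t)) (mBt t)).
rewrite big_split /=; congr (_ * _)%E.
  rewrite /paths_prob -(perm_big _ (permEl (perm_rev ps))) (big_nth [::]).
  by rewrite big_mkord size_rev sps prodEFin.
case: ifPn => [kt0|kt0]; last first.
  apply: big1 => t _; case: ifP => // kt; rewrite ifF ?probability_setT//.
  by apply: contraNF kt0 => /eqP <-.
have t0n : (t0 < n)%N.
  rewrite ltnNge; apply: contraTN kt0 => nt0.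
  by rewrite /nth_path nth_default// size_rev sps.
rewrite (bigD1 (Ordinal t0n))//= kt0 eqxx big1 ?mule1// => t tt0.
case: ifP => // _; rewrite ifF ?probability_setT//.
by apply: contraNF tt0 => /eqP ?; apply/eqP/val_inj.
Qed.

Lemma paths_event_prob ps : size ps = n ->
  P (paths_event ps) = (paths_prob M ps)%:E.
Proof.
(* Episode [n] is out of range, so its path is the default [[::]] and the reward condition is
   void. *)
move=> sps; have := @paths_event_law ps n 0 setT sps measurableT.
rewrite (_ : nth_path ps n = [::]) ?mule1 => [<-|].
  by congr (P _); apply/seteqP; split => w // [].
by rewrite /nth_path nth_default// size_rev sps.
Qed.

Lemma measurable_paths_event_reward ps t0 k B : size ps = n -> measurable B ->
  measurable (paths_event ps `&`
    [set w | (k.+1 < size (nth_path ps t0))%N -> B ((ep t0 w).2 k)]).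
Proof.
move=> sps mB; have [m_ep _ _] := ep_iid.
rewrite paths_event_bigcap//; apply: fin_bigcap_measurable.
  exact: finite_II.
by move=> t tn; apply: measurable_path_event; [exact: m_ep|case: ifP].
Qed.

Lemma measurable_paths_event ps : measurable (paths_event ps).
Proof.
have [sps|sps] := eqVneq (size ps) n; last first.
  rewrite (_ : paths_event ps = set0)//; apply/seteqP; split => w //= wps.
  by move: sps; rewrite -wps size_rev size_mkseq eqxx.
have := @measurable_paths_event_reward ps n 0 setT sps measurableT.
by congr (measurable _); apply/seteqP; split => w // [].
Qed.

(* Stated without division, as the paths [ps] may have probability 0. *)
Definition has_mean ps X x : Prop :=
  P.-integrable (paths_event ps) (EFin \o X) /\
  (\int[P]_(w in paths_event ps) (X w)%:E = (x * paths_prob M ps)%:E)%E.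

(** * Means given the paths of all episodes *)

Section HasMean.
Variable ps : seq (seq S).
Hypothesis size_ps : size ps = n.

Lemma eq_has_mean X Y x :
  {in paths_event ps, X =1 Y} -> has_mean ps X x -> has_mean ps Y x.
Proof.
move=> XY [iX IX]; split.
  apply: eq_integrable iX; first exact: measurable_paths_event.
  by move=> w Ew; rewrite /= XY.
by rewrite -IX; apply: eq_integral => w Ew; rewrite XY.
Qed.

Lemma has_mean_cst x : has_mean ps (fun=> x) x.
Proof.
have mE := measurable_paths_event ps; split.
  exact: finite_measure_integrable_cst.
by rewrite integral_cst// [X in (_ * X)%E]paths_event_prob.
Qed.

Lemma has_meanD X Y x y :
  has_mean ps X x -> has_mean ps Y y -> has_mean ps (X \+ Y) (x + y).
Proof.
move=> [iX IX] [iY IY]; have mE := measurable_paths_event ps; split.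
  rewrite (_ : EFin \o _ = (EFin \o X) \+ (EFin \o Y))%E//.
  exact: integrableD.
under eq_integral => w _ do rewrite EFinD.
by rewrite integralD// IX IY -EFinD mulrDl.
Qed.

Lemma has_meanZ c X x :
  has_mean ps X x -> has_mean ps (fun w => c * X w) (c * x).
Proof.
move=> [iX IX]; have mE := measurable_paths_event ps; split.
  rewrite (_ : EFin \o _ = fun w => c%:E * (EFin \o X) w)%E//.
  exact: integrableZl.
under eq_integral => w _ do rewrite EFinM.
by rewrite integralZl// IX -EFinM mulrA.
Qed.

Lemma has_mean_sum m (F : nat -> Omega -> R) (f : nat -> R) :
  (forall k, (k < m)%N -> has_mean ps (F k) (f k)) ->
  has_mean ps (fun w => \sum_(k < m) F k w) (\sum_(k < m) f k).
Proof.
elim: m => [|m IH] Ff.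
  rewrite big_ord0; apply: eq_has_mean (has_mean_cst 0) => w _.
  by rewrite big_ord0.
rewrite big_ord_recr.
apply: eq_has_mean (has_meanD (IH _) (Ff m (ltnSn m))) => [w _|k km].
  by rewrite big_ord_recr.
by apply: Ff; rewrite ltnW.
Qed.

(** Restricted to the event of these paths, the reward has the law of its transition scaled by
    [paths_prob M ps]. *)
Lemma has_mean_reward t k : (k.+1 < size (nth_path ps t))%N ->
  has_mean ps (fun w => (ep t w).2 k) (mean_rewards M s0 (nth_path ps t) k).
Proof.
move=> kt; pose X w : measurableTypeR R := (ep t w).2 k.
have mE := measurable_paths_event ps.
have prob_ge0 : 0 <= paths_prob M ps.
  by rewrite -lee_fin -(paths_event_prob size_ps).
have mX : measurable_fun (paths_event ps) X.
  move=> _ B mB; have := measurable_paths_event_reward t k size_ps mB.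
  congr (measurable (_ `&` _)); apply/seteqP.
  by split => w; [move/(_ kt)|move=> Bw _].
have X_law B : measurable B -> P (paths_event ps `&` X @^-1` B) =
    ((NngNum prob_ge0)%:num%:E * mrp_reward M (nth s0 (nth_path ps t) k)
       (nth s0 (nth_path ps t) k.+1) B)%E.
  move=> mB; have := paths_event_law t k size_ps mB; rewrite kt /= => <-.
  by congr (P (_ `&` _)); apply/seteqP; split => w; [move=> Bw _|move/(_ isT)].
(* The identity vanishes at 0, so 0 can serve as the point [y0]. *)
have m0 : measurable [set 0 : measurableTypeR R] by exact: measurable_set1.
have iR := mrp_reward_integrable M (nth s0 (nth_path ps t) k)
  (nth s0 (nth_path ps t) k.+1).
split.
  exact: (integrable_scaled_law mE mX m0 X_law _ iR).
rewrite (integral_scaled_law mE mX m0 X_law _ iR)// /mean_rewards /mean_reward.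
by rewrite EFinM muleC fineK// integrable_fin_num.
Qed.

Variables (lambda : R) (alpha : nat -> R) (V0 : S -> R).

Lemma has_mean_td_target (U : Omega -> S -> R) (u : S -> R) (z : S) xs
    (r : nat -> Omega -> R) (r' : nat -> R) :
  (forall y : S, has_mean ps (U ^~ y) (u y)) ->
  (forall k, (k < size xs)%N -> has_mean ps (r k) (r' k)) ->
  has_mean ps (fun w => td_target M lambda (U w) z xs (r ^~ w))
    (td_target M lambda u z xs r').
Proof.
move=> mU mr; pose b k := (mrp_discount M * lambda) ^+ k.
apply: has_meanD; last apply: has_meanZ.
  apply: (@has_mean_sum _ (fun k w => b k * r k w)
    (fun k => b k * r' k)) => k kxs.
  exact/has_meanZ/mr.
apply: (@has_mean_sum _ (fun k w => b k * U w (nth z xs k))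
  (fun k => b k * u (nth z xs k))) => k _.
exact: has_meanZ.
Qed.

(** For fixed [N] and [p] all branches of the update are decided, and what remains is affine in the
    estimates and rewards. *)
Lemma has_mean_td_update (N : S -> nat) (U : Omega -> S -> R) (u : S -> R) p
    (r : nat -> Omega -> R) (r' : nat -> R) :
  (forall y : S, has_mean ps (U ^~ y) (u y)) ->
  (forall k, (k.+1 < size p)%N -> has_mean ps (r k) (r' k)) ->
  forall z, has_mean ps
    (fun w => td_update M lambda alpha N (U w) p (r ^~ w) z)
    (td_update M lambda alpha N u p r' z).
Proof.
move=> mU; elim: p r r' => [|x' xs IH] r r' mr z /=; first exact: mU.
have mW := IH (fun k => r k.+1) (fun k => r' k.+1) (fun k => mr k.+1).
case: ifP => _; last exact: mW.
apply: has_meanD; first exact: has_meanZ.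
apply/has_meanZ/has_mean_td_target => [y|k kxs]; last exact: mr.
case: ifP => _; first exact: has_mean_cst.
by case: ifP => _; [exact: mW|exact: mU].
Qed.

Lemma visitsE (e : nat -> episode R S) t z :
  visits e t z = path_visits (past_paths e t) z.
Proof.
rewrite /path_visits /past_paths (perm_big _ (permEl (perm_rev _))) big_map.
rewrite /visits -(big_mkord xpredT (fun i => count_mem z (e i).1)).
by rewrite /index_iota subn0.
Qed.

Lemma has_mean_td_estimates t z : (t <= n)%N ->
  has_mean ps (fun w => td_estimates M lambda alpha V0 (ep ^~ w) t z)
    (mean_estimates M lambda alpha V0 s0 (rev (mkseq (nth_path ps) t)) z).
Proof.
elim: t z => [|t IH] z tn /=; first exact: has_mean_cst.
pose qs := rev (mkseq (nth_path ps) t).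
rewrite mkseqS rev_rcons /= -/qs.
have path_t w : w \in paths_event ps -> (ep t w).1 = nth_path ps t.
  by move=> /set_mem /paths_eventP; apply.
have past w : w \in paths_event ps -> past_paths (ep ^~ w) t = qs.
  move=> /set_mem/(paths_eventP _ size_ps) E; congr rev.
  apply/eq_in_map => i; rewrite mem_iota => /andP[_ it].
  by apply: E; apply: leq_trans tn; rewrite ltnW// ltnS.
apply: eq_has_mean => [w Ew|]; last first.
  apply: has_mean_td_update => [y|k kt]; first exact: IH (ltnW tn).
  exact: has_mean_reward.
rewrite path_t//; congr (td_update _ _ _ _ _ _ _ _).
by apply/funext => y; rewrite visitsE past.
Qed.

End HasMean.

(** * Summation over the lists of paths *)

Hypothesis M_acyclic : acyclic M.

(** A path of nonzero probability descends, hence repeats no state and has at most [#|S|] states. *)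
Lemma complete_path_prob_notin p : p \notin paths -> complete_path_prob M p = 0.
Proof.
move=> pP; apply/eqP; apply: contraNT pP.
move=> /(descending_complete_path M_acyclic)/descending_uniq/card_uniqP sp; rewrite mem_seqs_upto -sp.
rewrite (leq_trans (max_card _))//=; apply/allP => x _ /=.
by rewrite mem_index_enum.
Qed.

Lemma paths_prob_notin ps :
  size ps = n -> ps \notin seqs paths n -> paths_prob M ps = 0.
Proof.
move=> sps; rewrite mem_seqs sps eqxx /= => /allPn[p pps /= pP].
apply/eqP; rewrite /paths_prob prodf_seq_eq0; apply/hasP; exists p => //.
by rewrite complete_path_prob_notin /=.
Qed.

Lemma trivIset_paths_event (D : set (seq (seq S))) : trivIset D paths_event.
Proof. by move=> ps qs _ _ [w [<- <-]]. Qed.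

Lemma measurable_visits s m : measurable [set w | visits (ep ^~ w) n s = m].
Proof.
rewrite (_ : [set w | _] = \bigcup_(ps in [set: seq (seq S)])
    if path_visits ps s == m then paths_event ps else set0).
  apply: countable_bigcupT_measurable => [|ps]; first exact: countableP.
  by case: ifP => // _; exact: measurable_paths_event.
apply/seteqP; split => w /=.
  by move=> <-; exists (past_paths (ep ^~ w) n); rewrite // -visitsE eqxx.
by move=> [ps _]; case: eqP => // <- wps; rewrite visitsE wps.
Qed.

(** Up to a null set the event is a finite disjoint union of path events, on each of which the
    integral of [X] is known. *)
Lemma integral_visits s m X (x : seq (seq S) -> R) :
  (forall ps, size ps = n -> has_mean ps X (x ps)) ->
  (\int[P]_(w in [set w | visits (ep ^~ w) n s = m]) (X w)%:E =
   (\sum_(ps <- seqs paths n | path_visits ps s == m)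
      paths_prob M ps * x ps)%:E)%E.
Proof.
move=> mX; set A := [set w | _].
(* Numbering the countably many lists of paths through [unpickle] gives a sequence of events, to
   which countable additivity applies. *)
pose F (D : pred (seq (seq S))) i :=
  if unpickle i is Some ps
  then if [&& size ps == n, path_visits ps s == m & D ps]
       then paths_event ps else set0
  else set0.
have FE D : \bigcup_i F D i =
    [set w | visits (ep ^~ w) n s = m /\ D (past_paths (ep ^~ w) n)].
  apply/seteqP; split => w.
    move=> [i _]; rewrite /F; case: unpickle => // ps; case: ifP => //.
    by move=> /and3P[_ /eqP pm Dps] wps; rewrite /= visitsE wps pm.
  rewrite /= visitsE => -[wm Dw].
  exists (pickle (past_paths (ep ^~ w) n)) => //.
  by rewrite /F pickleK size_rev size_mkseq wm !eqxx Dw.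
have mF D i : measurable (F D i).
  rewrite /F; case: unpickle => // ps; case: ifP => // _.
  exact: measurable_paths_event.
have AE : A = \bigcup_i F xpredT i.
  by rewrite FE; apply/seteqP; split => w // [].
pose good := [seq ps <- seqs paths n | path_visits ps s == m].
pose T := \big[setU/set0]_(ps <- good) paths_event ps.
pose N := \bigcup_i F (fun ps => ps \notin seqs paths n) i.
have TE : T = [set w | visits (ep ^~ w) n s = m /\
    past_paths (ep ^~ w) n \in seqs paths n].
  rewrite /T -bigcup_seq; apply/seteqP; split => w.
    move=> [ps /=]; rewrite mem_filter => /andP[/eqP pm psP] wps.
    by rewrite visitsE wps pm.
  move=> [wm wP]; exists (past_paths (ep ^~ w) n) => //=.
  by rewrite mem_filter wP -visitsE wm eqxx.
have mT : measurable T.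
  by apply: bigsetU_measurable => ps _; exact: measurable_paths_event.
have mN : measurable N by exact: bigcupT_measurable.
have ATN : A = T `|` N.
  rewrite TE /N FE; apply/seteqP; split => w /=; last by case=> -[].
  move=> wm; have [|] := boolP (past_paths (ep ^~ w) n \in seqs paths n).
    by left.
  by right.
(* Measurability of [X] is known on each path event; countably many of them make up [A]. *)
have mX_A : measurable_fun A (EFin \o X).
  rewrite AE; apply/measurable_fun_bigcup => // i.
  rewrite /F; case: unpickle => [ps|]; last exact: measurable_fun_set0.
  case: ifP => [/andP[/eqP sps _]|_]; last exact: measurable_fun_set0.
  by have [/measurable_int] := mX _ sps.
have N0 : P N = 0%E.
  apply/negligibleP => //; apply: negligible_bigcup => i.
  apply/negligibleP => //; rewrite /F.
  case: unpickle => [ps|]; last exact: measure0.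
  case: ifP => [/and3P[/eqP sps _ psP]|_]; last exact: measure0.
  by rewrite [LHS]paths_event_prob// paths_prob_notin.
have mX_S B : B `<=` A -> measurable_fun B (EFin \o X).
  by move=> BA; apply: measurable_funS mX_A => //; exact: measurable_visits.
rewrite ATN integral_setU//; last 2 first.
- by rewrite -ATN.
- rewrite disj_set2E TE /N FE; apply/eqP/seteqP; split => w //.
  by move=> [[_ wP] [_ /negP]].
rewrite [X in (_ + X)%E]null_set_integral// ?adde0; last first.
  by apply: mX_S; rewrite ATN => w; right.
rewrite integral_bigsetU_EFin//.
- rewrite big_filter big_seq_cond [in RHS]big_seq_cond -sumEFin.
  apply: eq_bigr => ps /andP[]; rewrite mem_seqs => /andP[/eqP sps _] _.
  by have [_ ->] := mX _ sps; rewrite mulrC.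
- by move=> ps; exact: measurable_paths_event.
- exact/filter_uniq/seqs_uniq/seqs_upto_uniq/index_enum_uniq.
- exact: trivIset_paths_event.
- by apply: mX_S; rewrite ATN => w; left.
Qed.

End EpisodesLaw.

Theorem theorem8 (R : realType) (S : finType) (M : mrp R S) (V : S -> R)
    (d : measure_display) (Omega : measurableType d) (P : probability Omega R)
    (n : nat) (ep : nat -> Omega -> episode R S)
    (lambda : R) (alpha : nat -> R) (V0 : S -> R)
    (M_acyclic : acyclic M) (V_value : is_value M V)
    (ep_iid : iid_episodes M P n ep)
    (lambda01 : 0 <= lambda <= 1)
    (alpha01 : forall k, (1 <= k)%N -> 0 <= alpha k <= 1)
    (alpha1 : alpha 1%N = 1)
    (s : S) (m : nat) (m_ge1 : (1 <= m)%N) :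
  let K w := visits (ep ^~ w) n s in
  (0 < P [set w | K w = m])%E ->
  cond_expectation P
    (fun w => td_estimator M lambda alpha V0 (ep ^~ w) n s)
    [set w | K w = m] = (V s)%:E.
Proof.
move=> K; rewrite /cond_expectation /td_estimator => PK.
have [ts|_] := boolP (terminal M s).
  by rewrite integral0 mul0e (value_terminal V_value ts).
pose c := \sum_(ps <- seqs paths n | path_visits ps s == m) paths_prob M ps.
have PKE : P [set w | K w = m] = c%:E.
  (* The integral of the constant 1 gives the probability of the event. *)
  have := integral_visits s ep_iid M_acyclic s m (fun ps sps =>
    has_mean_cst s ep_iid sps 1).
  under eq_bigr => ps _ do rewrite mulr1.
  by rewrite integral_cst ?mul1e//; exact: (measurable_visits ep_iid).
have -> : (\int[P]_(w in [set w | K w = m])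
    (td_estimates M lambda alpha V0 (ep ^~ w) n s)%:E = (V s * c)%:E)%E.
  rewrite (integral_visits s ep_iid M_acyclic s m (x := fun ps =>
    mean_estimates M lambda alpha V0 s ps s)) => [|ps sps]; last first.
    have := has_mean_td_estimates s ep_iid sps lambda alpha V0 s (leqnn n).
    rewrite (_ : rev _ = ps)//; apply: (can_inj revK).
    by rewrite revK -sps -size_rev /nth_path mkseq_nth.
  congr EFin; apply/eqP; rewrite -subr_eq0 /c mulr_sumr -sumrB; apply/eqP.
  (* The test function is the indicator of [m] visits to [s], which the filter at the height of [s]
     preserves; [m_ge1] turns the factor for having been visited into 1. *)
  rewrite -[RHS](mean_estimates_unbiased
    lambda V0 s M_acyclic V_value alpha1 n s
    (fun l => (path_visits l s == m)%:R)).
  rewrite big_mkcond; apply: eq_bigr => ps _.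
  rewrite path_visits_upto_height//; case: eqP => [->|_].
    by rewrite m_ge1 !mul1r; ring.
  by rewrite mulr0 mul0r mulr0.
rewrite PKE in PK *; rewrite lte_fin in PK.
by rewrite inver gt_eqF// -EFinM mulfK// gt_eqF.
Qed.
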